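(* Let $0<\alpha\le 1$, let $(\boldsymbol{\pi},\boldsymbol{T})$ be a phase-type generator, and let $X\sim \mathrm{MML}(\alpha,\boldsymbol{\pi},\boldsymbol{T})$. Then $$X\stackrel{d}{=}W^{1/\alpha}S_\alpha,$$ where $W\sim \mathrm{PH}(\boldsymbol{\pi},\boldsymbol{T})$, and $S_\alpha$ is a (positive stable) random variable, independent of $W$, with Laplace transform $\mathbb{E}(e^{-uS_\alpha})=\exp(-u^{\alpha})$, $u\ge 0$.
   Context: Phase-type (PH) generator: a pair $(\boldsymbol{\pi},\boldsymbol{T})$ where, for some integer $p\ge 1$, $\boldsymbol{\pi}=(\pi_1,\dots,\pi_p)$ is a row vector with $\pi_i\ge 0$, $\sum_i\pi_i=1$, and $\boldsymbol{T}=(t_{ij})$ is a $p\times p$ sub-intensity matrix such that $$\boldsymbol{\Lambda}=\begin{pmatrix}\boldsymbol{T}&\boldsymbol{t}\\ \boldsymbol{0}&0\end{pmatrix},\qquad \boldsymbol{t}=-\boldsymbol{T}\boldsymbol{e},$$ is the intensity matrix of a time-homogeneous Markov jump process on $\{1,\dots,p,p+1\}$ in which the states $1,\dots,p$ are transient and $p+1$ is absorbing. Here $\boldsymbol{e}=(1,\dots,1)'$ is the $p$-dimensional column vector of ones. Thus the off-diagonal entries of $\boldsymbol{T}$ and the entries of $\boldsymbol{t}$ are nonnegative, and transience means that $\boldsymbol{T}$ is invertible. The distribution $\mathrm{PH}(\boldsymbol{\pi},\boldsymbol{T})$ is that of the time until absorption of this process started with initial distribution $\boldsymbol{\pi}$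 on $\{1,\dots,p\}$; it has density $\boldsymbol{\pi}e^{\boldsymbol{T}x}\boldsymbol{t}$, $x>0$. Matrix Mittag-Leffler distribution: for $0<\alpha\le1$ and a PH generator $(\boldsymbol{\pi},\boldsymbol{T})$, $X\sim\mathrm{MML}(\alpha,\boldsymbol{\pi},\boldsymbol{T})$ means that $X$ is a nonnegative random variable with Laplace transform $\mathbb{E}(e^{-uX})=\boldsymbol{\pi}(u^\alpha\boldsymbol{I}-\boldsymbol{T})^{-1}\boldsymbol{t}$, $u\ge0$, where $\boldsymbol{I}$ is the identity matrix. *)

(* Defs.v *)
From HB Require Import structures.
From mathcomp Require Import all_boot all_order all_algebra.
From mathcomp Require Import all_classical all_reals all_analysis.

Set Implicit Arguments.
Unset Strict Implicit.
Unset Printing Implicit Defensive.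

Import Order.TTheory GRing.Theory Num.Theory.
Import numFieldNormedType.Exports.

Local Open Scope classical_set_scope.
Local Open Scope ring_scope.

Section PhaseType.
Context {R : realType} {p : nat}.
Implicit Types (pi : 'rV[R]_p) (T : 'M[R]_p).

Definition exit_rates T : 'cV[R]_p := - (T *m const_mx 1).

(* On finitely many states with rows summing to 0, transience of the states
   1, ..., p means exactly that T is invertible. *)
Record PH_generator pi T : Prop := {
  PH_size_gt0 : (0 < p)%N;
  PH_init_ge0 : forall i, 0 <= pi 0 i;
  PH_init_sum1 : \sum_i pi 0 i = 1;
  PH_offdiag_ge0 : forall i j, i != j -> 0 <= T i j;
  PH_exit_ge0 : forall i, 0 <= exit_rates T i 0;
  PH_transient : T \in unitmx
}.

(* Λ = (T t; 0 0) *)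
Definition full_intensity T : 'M[R]_(p + 1) :=
  block_mx T (exit_rates T) 0 0.

Definition absorbing_state : 'I_(p + 1) := rshift p ord0.

End PhaseType.

Section JumpProcess.
Context {R : realType} {n : nat}.
Implicit Types (Pt : R -> 'M[R]_n) (L : 'M[R]_n) (nu : 'rV[R]_n).

(* Only the values of Pt on [0, +oo[ matter.  The intensity matrix is the
   right derivative of the transition matrices at time 0. *)
Record transition_semigroup Pt L : Prop := {
  transition_ge0 : forall (t : R) i j, 0 <= t -> 0 <= Pt t i j;
  transition_sum1 : forall (t : R) i, 0 <= t -> \sum_j Pt t i j = 1;
  transition0 : Pt 0 = 1%:M;
  transitionD : forall s t : R, 0 <= s -> 0 <= t -> Pt (s + t) = Pt s *m Pt t;
  transition_intensity : forall i j,
    h^-1 * (Pt h i j - (1%:M : 'M[R]_n) i j) @[h --> 0^'+] --> L i j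
}.

(* The Markov property is stated with the conditional probabilities multiplied
   out: P(Y_{t_0} = i_0, ..., Y_{t_m} = i_m, Y_{t_m + s} = j)
        = P(Y_{t_0} = i_0, ..., Y_{t_m} = i_m) * Pt(s)_{i_m, j}. *)
Record markov_jump_process d (O : measurableType d) (Q : probability O R)
    (Y : R -> O -> 'I_n) nu L : Prop := {
  jump_measurable : forall (t : R) i, 0 <= t -> measurable [set w | Y t w = i];
  jump_right_continuous : forall w (t : R), 0 <= t ->
    \forall s \near t^'+, Y s w = Y t w;
  jump_left_limit : forall w (t : R), 0 < t ->
    exists i, \forall s \near t^'-, Y s w = i;
  jump_init : forall i, Q [set w | Y 0 w = i] = (nu 0 i)%:E;
  jump_markov : exists2 Pt : R -> 'M[R]_n, transition_semigroup Pt L &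
    forall (m : nat) (t : nat -> R) (i : nat -> 'I_n) (s : R) (j : 'I_n),
      0 <= t 0%N -> (forall k, t k <= t k.+1) -> 0 <= s ->
      let past := \bigcap_(k in `I_m.+1) [set w | Y (t k) w = i k] in
      Q (past `&` [set w | Y (t m + s) w = j]) =
      (Q past * (Pt s (i m) j)%:E)%E
}.

(* Equal to +oo when the state j is never visited. *)
Definition hitting_time d (O : measurableType d) (Y : R -> O -> 'I_n)
    (j : 'I_n) (w : O) : \bar R :=
  ereal_inf [set t%:E | t in [set t : R | 0 <= t /\ Y t w = j]].

End JumpProcess.

Section Distributions.
Context {R : realType}.

(* W ~ PH(pi, T): W has the law of the time until absorption of a Markov jump
   process with intensity matrix Λ, on some probability space, started in
   {1, ..., p} according to pi. *)
Definition PH_distributed d (O : measurableType d) (P : probability O R)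
    (W : {RV P >-> R}) (p : nat) (pi : 'rV[R]_p) (T : 'M[R]_p) : Prop :=
  exists (d' : measure_display) (O' : measurableType d')
    (Q : probability O' R) (Y : R -> O' -> 'I_(p + 1)),
    markov_jump_process Q Y (row_mx pi 0) (full_intensity T) /\
    forall A : set R, measurable A ->
      distribution P W A =
      Q [set w | (EFin @` A) (hitting_time Y absorbing_state w)].

Definition laplace_transform d (O : measurableType d) (P : probability O R)
    (X : O -> R) (u : R) : \bar R := ('E_P[fun w => expR (- (u * X w))])%E.

Definition MML_distributed d (O : measurableType d) (P : probability O R)
    (X : {RV P >-> R}) (alpha : R) (p : nat) (pi : 'rV[R]_p) (T : 'M[R]_p)
    : Prop :=
  {ae P, forall w, 0 <= X w} /\
  forall u : R, 0 <= u ->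
    laplace_transform P X u =
    ((pi *m invmx ((u `^ alpha)%:M - T) *m exit_rates T) 0 0)%:E.

Definition positive_stable d (O : measurableType d) (P : probability O R)
    (S : {RV P >-> R}) (alpha : R) : Prop :=
  {ae P, forall w, 0 < S w} /\
  forall u : R, 0 <= u -> laplace_transform P S u = (expR (- u `^ alpha))%:E.

Definition independent_RV d (O : measurableType d) (P : probability O R)
    (X Y : {RV P >-> R}) : Prop :=
  forall A B : set R, measurable A -> measurable B ->
    P (X @^-1` A `&` Y @^-1` B) = (P (X @^-1` A) * P (Y @^-1` B))%E.

Definition eq_in_law d1 (O1 : measurableType d1) (P1 : probability O1 R)
    d2 (O2 : measurableType d2) (P2 : probability O2 R)
    (X1 : O1 -> R) (X2 : O2 -> R) : Prop :=
  forall A : set R, measurable A ->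
    pushforward P1 X1 A = pushforward P2 X2 A.

End Distributions.

(* Main.v *)
(** Laplace transforms determine laws on [0, +oo[, so it suffices to compare
    those of [X] and of [W `^ alpha^-1 * S].  Conditioning on [W] and using
    stability of [S], the latter at [u] is the Laplace transform of [W] at
    [u `^ alpha], which is the resolvent expression of the MML distribution.

    Uniqueness reduces to the Hausdorff moment problem for [expR (- X)], solved
    with Bernstein polynomials.  The Laplace transform of [W] is computed
    without matrix exponentials: with [U t] the block of transition
    probabilities between transient states, [P(W > t) = pi U(t) e], and the
    lower and upper Riemann sums of [E (expR (- s W))] on a grid of step [h]
    telescope, up to an error that only involves the right derivative [T] of
    [U] at 0, to [pi c], where [c = (s I - T)^-1 t]. *)
Require Import Defs.
From HB Require Import structures.
From mathcomp Require Import all_boot all_order all_algebra.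
From mathcomp Require Import all_classical all_reals all_analysis.
From mathcomp Require Import measurable_realfun ring lra.

Set Implicit Arguments.
Unset Strict Implicit.
Unset Printing Implicit Defensive.

Import Order.TTheory GRing.Theory Num.Theory.
Import numFieldNormedType.Exports.

Local Open Scope classical_set_scope.
Local Open Scope ring_scope.

(** * Uniform approximation of Lipschitz functions by Bernstein polynomials *)

Section Bernstein.
Context {R : realType}.
Implicit Types (f g : nat -> R) (y : R).

(** The polynomial [\sum_(k <= n) f k * 'C(n, k) * 'X^k * (1 - 'X)^(n - k)], by
    the recursion on [n] that conditions on the first of [n] coin tosses. *)
Fixpoint bernstein n f : {poly R} :=
  if n is m.+1 then
    (1 - 'X) * bernstein m f + 'X * bernstein m (fun k => f k.+1)
  else (f 0%N)%:P.

Lemma bernsteinS n f y : (bernstein n.+1 f).[y] =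
  (1 - y) * (bernstein n f).[y] + y * (bernstein n (fun k => f k.+1)).[y].
Proof. by rewrite /= !hornerE. Qed.

Lemma bernstein_linear n (a b : R) f g y :
  (bernstein n (fun k => a * f k + b * g k)).[y] =
  a * (bernstein n f).[y] + b * (bernstein n g).[y].
Proof.
elim: n f g => [|n IH] f g; first by rewrite !hornerE.
rewrite !bernsteinS IH (IH (fun k => f k.+1) (fun k => g k.+1)); ring.
Qed.

Lemma bernstein_le n f g y : 0 <= y <= 1 -> (forall k, f k <= g k) ->
  (bernstein n f).[y] <= (bernstein n g).[y].
Proof.
move=> /andP[y0 y1]; elim: n f g => [|n IH] f g fg; first by rewrite !hornerE.
by rewrite !bernsteinS lerD// ler_wpM2l ?subr_ge0 ?IH.
Qed.

Lemma bernstein_cst n (a : R) y : (bernstein n (fun=> a)).[y] = a.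
Proof.
by elim: n => [|n IH]; [rewrite hornerE | rewrite bernsteinS IH; ring].
Qed.

(** Variance plus squared bias of a binomial variable. The shift [a] is kept general because the
    recursion replaces [k] by [k.+1], that is [a] by [1 + a]. *)
Lemma bernstein_variance n (a y : R) :
  (bernstein n (fun k => (k%:R + a) ^+ 2)).[y] =
  n%:R * y * (1 - y) + (n%:R * y + a) ^+ 2.
Proof.
elim: n a => [|n IH] a; first by rewrite hornerE; ring.
rewrite bernsteinS IH.
under eq_fun do rewrite -natr1 -addrA.
by rewrite IH -natr1; ring.
Qed.

(** Young's inequality bounds the Lipschitz modulus by [e / 2] plus a multiple of [(x - y) ^+ 2];
    the Bernstein average of that square is the variance of a binomial frequency, of order 1/n. *)
Lemma lipschitz_poly_approx (f : R -> R) (L e : R) :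
    (forall x y, `|f x - f y| <= L * `|x - y|) -> 0 < e ->
  exists q : {poly R}, forall y, 0 <= y <= 1 -> `|q.[y] - f y| <= e.
Proof.
move=> fL e0.
(* Chosen so that [e / 2 + C * t ^+ 2 - L * t] is the square [(e - L * t) ^+ 2] divided by
   [2 * e]. *)
pose C := L ^+ 2 / (2 * e).
have AM x y : `|f x - f y| <= e / 2 + C * (x - y) ^+ 2.
  apply: (le_trans (fL x y)); rewrite -[(x - y) ^+ 2]real_normK ?num_real//.
  move: `|x - y| => t; rewrite /C.
  have -> : e / 2 + L ^+ 2 / (2 * e) * t ^+ 2 =
      L * t + (e - L * t) ^+ 2 / (2 * e).
    by field; rewrite gt_eqF.
  by rewrite lerDl divr_ge0 ?sqr_ge0// mulr_ge0 ?ltW.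
(* Makes [C / n.+1%:R] smaller than [e / 2]. *)
have [n Cn] : exists n : nat, C * 2 / e < n.+1%:R.
  have := archi_boundP (x := `|C * 2 / e|) (normr_ge0 _).
  set n := Num.bound _ => Hn; exists n.
  by rewrite (le_lt_trans (ler_norm _))// (lt_trans Hn)// ltr_nat.
have n0 : (0 : R) < n.+1%:R by [].
have C0 : 0 <= C by rewrite divr_ge0 ?sqr_ge0// mulr_ge0 ?ltW.
exists (bernstein n.+1 (fun k => f (k%:R / n.+1%:R))) => y y01.
have /andP[y0 y1] := y01.
have key k : `|f (k%:R / n.+1%:R) - f y| <=
    e / 2 * 1 + C / n.+1%:R ^+ 2 * (k%:R + - (n.+1%:R * y)) ^+ 2.
  apply: (le_trans (AM _ _)); rewrite mulr1 lerD2l.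
  rewrite le_eqVlt; apply/orP; left; apply/eqP; field.
  by rewrite addrC natr1 gt_eqF.
have bnd : e / 2 + C / n.+1%:R ^+ 2 * (n.+1%:R * y * (1 - y) +
    (n.+1%:R * y + - (n.+1%:R * y)) ^+ 2) <= e.
  rewrite subrr expr0n /= addr0.
  have -> : C / n.+1%:R ^+ 2 * (n.+1%:R * y * (1 - y)) =
      C / n.+1%:R * (y * (1 - y)).
    by field; rewrite addrC natr1 gt_eqF.
  rewrite [leRHS]splitr lerD2l (@le_trans _ _ (C / n.+1%:R))//.
    have yy : y * (1 - y) <= 1 by nra.
    by rewrite ler_piMr// divr_ge0.
  rewrite ler_pdivrMr//; move: Cn; rewrite ltr_pdivrMr//; lra.
(* Constants are their own Bernstein polynomials, so the error is the Bernstein polynomial of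
   [f - f y], and monotonicity carries the pointwise bound [key] over to it. *)
have sub : (bernstein n.+1 (fun k => f (k%:R / n.+1%:R))).[y] - f y =
  (bernstein n.+1 (fun k => 1 * f (k%:R / n.+1%:R) + -1 * f y)).[y].
  by rewrite bernstein_linear bernstein_cst; ring.
rewrite sub ler_norml; apply/andP; split.
  pose h k := e / 2 * 1 + C / n.+1%:R ^+ 2 * (k%:R + - (n.+1%:R * y)) ^+ 2.
  have hE : (bernstein n.+1 h).[y] <= e.
    by rewrite bernstein_linear bernstein_cst bernstein_variance mulr1.
  apply: (@le_trans _ _ (bernstein n.+1 (fun k => -1 * h k + 0 * h k)).[y]).
    by rewrite bernstein_linear mul0r addr0 mulN1r lerN2.
  apply: bernstein_le => // k; rewrite mul0r addr0 !mulN1r mul1r lerNl opprB.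
  by rewrite (le_trans _ (key k))// distrC ler_norm.
apply: le_trans (bernstein_le _ y01 _) _.
  by move=> k; apply: le_trans (key k); rewrite mul1r mulN1r ler_norm.
by rewrite bernstein_linear bernstein_cst bernstein_variance mulr1.
Qed.

End Bernstein.

(** * Integrals of bounded random variables and of polynomials in them *)

Section BoundedIntegrals.
Context {R : realType} d (O : measurableType d) (P : probability O R).
Implicit Types f g : O -> R.

Lemma integrable_bounded f (M : R) : measurable_fun setT f ->
  (forall w, `|f w| <= M) -> P.-integrable setT (EFin \o f).
Proof.
move=> mf fM; apply: measurable_bounded_integrable => //.
  by rewrite -ge0_fin_numE// fin_num_measure.
exists M; split; first exact: num_real.
by move=> x Mx w _; exact: le_trans (fM w) (ltW Mx).
Qed.

Lemma Rintegral_probability_cst (c : R) : \int[P]_w c = c.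
Proof. by rewrite Rintegral_cst//= probability_setT mulr1. Qed.

Lemma Rintegral_sum (n : nat) (F : 'I_n -> O -> R) :
  (forall i, P.-integrable setT (EFin \o F i)) ->
  \int[P]_w (\sum_i F i w) = \sum_i \int[P]_w F i w.
Proof.
move=> intF; rewrite /Rintegral.
under eq_integral do rewrite -sumEFin.
rewrite (integral_sum measurableT intF).
by rewrite -sum_fine// => i _; apply: integrable_fin_num.
Qed.

Lemma Rintegral_horner f (M : R) (q : {poly R}) : measurable_fun setT f ->
  (forall w, `|f w| <= M) ->
  \int[P]_w q.[f w] = \sum_(i < size q) q`_i * \int[P]_w (f w ^+ i).
Proof.
move=> mf fM.
have M0 (w : O) : 0 <= M by rewrite (le_trans _ (fM w)).
have int i : P.-integrable setT (EFin \o (fun w => f w ^+ i)).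
  apply: (integrable_bounded (M := M ^+ i)); first exact: measurable_funX.
  by move=> w; rewrite normrX lerXn2r ?nnegrE ?(M0 w).
under eq_Rintegral do rewrite horner_coef.
rewrite Rintegral_sum.
  by apply: eq_bigr => i _; rewrite RintegralZl.
by move=> i; apply: (integrableZl _ _ (int i)).
Qed.

End BoundedIntegrals.

(** * Moments on [0, 1], then Laplace transforms, determine laws *)

Section MomentProblem.
Context {R : realType}.

(** The half-lines []x, +oo[] are stable under intersection, generate the Borel sets and exhaust the
    line along [- n%:R], so finite measures that agree on them are equal. *)
Lemma eq_in_law_ccdf d1 (O1 : measurableType d1) (P1 : probability O1 R)
    d2 (O2 : measurableType d2) (P2 : probability O2 R)
    (X1 : {RV P1 >-> R}) (X2 : {RV P2 >-> R}) :
  (forall x, ccdf X1 x = ccdf X2 x) -> eq_in_law P1 P2 X1 X2.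
Proof.
move=> ccdfE A mA.
apply: (measure_unique (@RGenOInfty.G R) (fun n => `]- n%:R, +oo[%classic)
  _ _ _ _ (distribution P1 X1) (distribution P2 X2)) => //.
- exact: RGenOInfty.measurableE.
- move=> _ _ [x ->] [y ->]; exists (Num.max x y).
  by apply/seteqP; split => z /=; rewrite !in_itv/= !andbT gt_max => /andP.
- by move=> n; exists (- n%:R).
- rewrite -subTset => x _; exists (Num.bound `|x|) => //=.
  rewrite in_itv /= andbT; have := archi_boundP (normr_ge0 x).
  by rewrite ltrNl; apply: le_lt_trans; rewrite -normrN ler_norm.
- by move=> _ [x ->]; exact: ccdfE.
- by move=> n; rewrite ltey_eq fin_num_measure.
Qed.

(** On [0, 1] a Lipschitz [f] is uniformly close to a polynomial, whose integral is a combination of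
    moments. *)
Lemma moments_lipschitz d1 (O1 : measurableType d1) (P1 : probability O1 R)
    d2 (O2 : measurableType d2) (P2 : probability O2 R)
    (X1 : {RV P1 >-> R}) (X2 : {RV P2 >-> R}) (f : R -> R) (L : R) :
  (forall w, 0 <= X1 w <= 1) -> (forall w, 0 <= X2 w <= 1) ->
  (forall n, \int[P1]_w (X1 w ^+ n) = \int[P2]_w (X2 w ^+ n)) ->
  measurable_fun setT f -> (forall x, 0 <= f x <= 1) ->
  (forall x y, `|f x - f y| <= L * `|x - y|) ->
  \int[P1]_w f (X1 w) = \int[P2]_w f (X2 w).
Proof.
move=> X1b X2b mom mf f01 fL.
have X1n w : `|X1 w| <= 1 by have /andP[? ?] := X1b w; rewrite ger0_norm.
have X2n w : `|X2 w| <= 1 by have /andP[? ?] := X2b w; rewrite ger0_norm.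
apply/eqP; rewrite -subr_eq0 -normr_le0; apply/ler_addgt0Pl => e e0.
rewrite addr0.
have [q qf] := lipschitz_poly_approx fL (divr_gt0 e0 (ltr0n R 2)).
have approx d (O : measurableType d) (P : probability O R) (X : {RV P >-> R}) :
    (forall w, 0 <= X w <= 1) ->
    `|\int[P]_w q.[X w] - \int[P]_w f (X w)| <= e / 2.
  move=> X01.
  have intf : P.-integrable setT (EFin \o (fun w => f (X w))).
    apply: (@integrable_bounded _ _ _ _ _ 1); first exact: measurableT_comp.
    by move=> w; have /andP[? ?] := f01 (X w); rewrite ger0_norm.
  have intq : P.-integrable setT (EFin \o (fun w => q.[X w])).
    apply: (@integrable_bounded _ _ _ _ _ (1 + e / 2)).
      apply: measurableT_comp => //; apply: continuous_measurable_fun.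
      exact: continuous_horner.
    move=> w; rewrite -[q.[_]](subrK (f (X w))) (le_trans (ler_normD _ _))//.
    rewrite addrC lerD ?qf//.
    by have /andP[? ?] := f01 (X w); rewrite ger0_norm.
  rewrite -RintegralB// (le_trans (le_normr_Rintegral _ _))//.
    exact: (integrableB measurableT intq intf).
  rewrite -[leRHS](Rintegral_probability_cst P) le_Rintegral//.
  - by apply: integrable_norm; exact: (integrableB measurableT intq intf).
  - exact: finite_measure_integrable_cst.
  - by move=> w _; exact: qf.
have qE : \int[P1]_w q.[X1 w] = \int[P2]_w q.[X2 w].
  by rewrite !(@Rintegral_horner _ _ _ _ _ 1)//; under eq_bigr do rewrite mom.
have := approx _ _ P1 X1 X1b; have := approx _ _ P2 X2 X2b; rewrite qE.
rewrite !ler_norml => /andP[? ?] /andP[? ?]; apply/andP; split; lra.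
Qed.

Lemma eq_measure_ae d (O : measurableType d) (mu : {measure set O -> \bar R})
    (A B : set O) : measurable A -> measurable B ->
  {ae mu, forall w, A w <-> B w} -> mu A = mu B.
Proof.
move=> mA mB AB; rewrite -[A]setIT -[B]setIT -!integral_indic//.
apply: ge0_ae_eq_integral => //.
- exact/measurable_EFinP/measurable_indic.
- exact/measurable_EFinP/measurable_indic.
- apply: filterS AB => w ABw _; rewrite !indicE.
  by have -> : (w \in A) = (w \in B) by apply/idP/idP; rewrite !inE => /ABw.
Qed.

Lemma integrable_indic_RV d (O : measurableType d) (P : probability O R)
    (X : {RV P >-> R}) (A : set R) : measurable A ->
  P.-integrable setT (EFin \o (fun w => \1_A (X w))).
Proof.
move=> mA; apply: (@integrable_bounded _ _ _ _ _ 1).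
  by apply: measurableT_comp => //; exact: measurable_indic.
by move=> w; rewrite indicE; case: (_ \in _); rewrite ?normr1 ?normr0.
Qed.

Lemma distribution_Rintegral d (O : measurableType d) (P : probability O R)
    (X : {RV P >-> R}) (A : set R) : measurable A ->
  distribution P X A = (\int[P]_w \1_A (X w))%:E.
Proof.
move=> mA; rewrite /Rintegral fineK; last first.
  by apply: integrable_fin_num => //; exact: integrable_indic_RV.
rewrite /distribution /pushforward -[X in P X]setIT -integral_indic//.
exact: measurable_funPTI.
Qed.

(** Random variables here are nonnegative only almost surely. Truncating at 0 makes the integrand at
    most 1 at every point, and [laplace_transform_pos] shows that the integral is then unchanged. *)
Lemma integrable_laplace_pos d (O : measurableType d) (P : probability O R)
    (X : {RV P >-> R}) (s : R) : 0 <= s ->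
  P.-integrable setT (EFin \o (fun w => expR (- (s * Num.max 0 (X w))))).
Proof.
move=> s0; apply: (@integrable_bounded _ _ _ _ _ 1).
  apply: measurableT_comp => //; apply: measurable_funN.
  by apply: measurable_funM => //; exact: measurable_maxr.
move=> w; rewrite ger0_norm ?expR_ge0// -expR0 ler_expR oppr_le0.
by rewrite mulr_ge0// le_max lexx.
Qed.

Lemma laplace_transform_pos d (O : measurableType d) (P : probability O R)
    (X : {RV P >-> R}) (s : R) : 0 <= s -> {ae P, forall w, 0 <= X w} ->
  laplace_transform P X s = (\int[P]_w expR (- (s * Num.max 0 (X w))))%:E.
Proof.
move=> s0 X0; have int := integrable_laplace_pos X s0.
rewrite /Rintegral fineK; last exact: integrable_fin_num int.
rewrite /laplace_transform unlock; apply: ae_eq_integral => //.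
- apply/measurable_EFinP; apply: measurableT_comp => //.
  by apply: measurable_funN; exact: measurable_funM.
- by have /integrableP[] := int.
- by apply: filterS X0 => w Xw _; rewrite max_r.
Qed.

(** A ramp separates the indicators of []x + h, +oo[] and []x, +oo[] and has the same integral under
    both laws; right continuity then lets [h] tend to 0. Exchanging the two laws gives the converse
    inequality. *)
Lemma ccdf_le_moments d1 (O1 : measurableType d1) (P1 : probability O1 R)
    d2 (O2 : measurableType d2) (P2 : probability O2 R)
    (X1 : {RV P1 >-> R}) (X2 : {RV P2 >-> R}) :
  (forall w, 0 <= X1 w <= 1) -> (forall w, 0 <= X2 w <= 1) ->
  (forall n, \int[P1]_w (X1 w ^+ n) = \int[P2]_w (X2 w ^+ n)) ->
  forall x, (ccdf X1 x <= ccdf X2 x)%E.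
Proof.
move=> X1b X2b mom x.
have le_h (h : R) : 0 < h -> (ccdf X1 (x + h) <= ccdf X2 x)%E.
  (* Ramp equal to 0 up to [x] and to 1 from [x + h] on, with slope [h^-1] in between. *)
  move=> h0; pose f y := Num.min 1 (Num.max 0 (h^-1 * (y - x))).
  have mf : measurable_fun setT f.
    apply: measurable_minr => //; apply: measurable_maxr => //.
    by apply: measurable_funM => //; exact: measurable_funB.
  have f01 y : 0 <= f y <= 1.
    by rewrite /f le_min ler01 le_max lexx ge_min lexx.
  have fL y z : `|f y - f z| <= h^-1 * `|y - z|.
    rewrite -[h^-1 in leRHS]gtr0_norm ?invr_gt0// -normrM.
    have -> : h^-1 * (y - z) = h^-1 * (y - x) - h^-1 * (z - x) by ring.
    rewrite /f; move: (h^-1 * (y - x)) (h^-1 * (z - x)) => a b.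
    have := ler_norm (a - b); have := ler_norm (b - a); rewrite (distrC b a).
    move: `|a - b| => t ? ?; rewrite ler_norml.
    case: (ltP 0 a) => ?; case: (ltP 0 b) => ?; rewrite /Order.min;
      do ?(case: ifPn; rewrite -?leNgt => ?); apply/andP; split; lra.
  have fint d (O : measurableType d) (P : probability O R) (X : {RV P >-> R}) :
      P.-integrable setT (EFin \o (fun w => f (X w))).
    apply: (@integrable_bounded _ _ _ _ _ 1); first exact: measurableT_comp.
    by move=> w; have /andP[? ?] := f01 (X w); rewrite ger0_norm.
  rewrite /ccdf !distribution_Rintegral// lee_fin.
  apply: (@le_trans _ _ (\int[P1]_w f (X1 w))).
    apply: le_Rintegral => //; [exact: integrable_indic_RV|exact: fint|].
    move=> w _; rewrite indicE; case: (boolP (_ \in _)) => [|_]; last first.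
      by have /andP[] := f01 (X1 w).
    rewrite inE /= in_itv/= andbT => xX; rewrite /f le_min lexx le_max.
    by rewrite mulrC ler_pdivlMr// mul1r lerBrDl (ltW xX) orbT.
  rewrite (moments_lipschitz X1b X2b mom mf f01 fL).
  apply: le_Rintegral => //; [exact: fint|exact: integrable_indic_RV|].
  move=> w _; rewrite indicE; case: (boolP (_ \in _)) => [_|].
    by have /andP[] := f01 (X2 w).
  rewrite notin_setE /= in_itv/= andbT => /negP; rewrite -leNgt => Xx.
  rewrite /f max_l ?ge_min ?lexx ?orbT//.
  by rewrite mulr_ge0_le0// ?invr_ge0 ?subr_le0// ltW.
apply: (cvge_le _ (@ccdf_right_continuous _ _ _ _ X1 x)).
near=> y; rewrite -(subrKC x y); apply: le_h.
by rewrite subr_gt0.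
Unshelve. all: by end_near.
Qed.

Lemma moments_inj d1 (O1 : measurableType d1) (P1 : probability O1 R)
    d2 (O2 : measurableType d2) (P2 : probability O2 R)
    (X1 : {RV P1 >-> R}) (X2 : {RV P2 >-> R}) :
  (forall w, 0 <= X1 w <= 1) -> (forall w, 0 <= X2 w <= 1) ->
  (forall n, \int[P1]_w (X1 w ^+ n) = \int[P2]_w (X2 w ^+ n)) ->
  eq_in_law P1 P2 X1 X2.
Proof.
move=> X1b X2b mom; apply: eq_in_law_ccdf => x.
by apply/eqP; rewrite eq_le !ccdf_le_moments.
Qed.

(** The moments of [expR (- X)] are the values of the Laplace transform at the integers, and [- ln]
    recovers [X] from this variable wherever [X] is nonnegative. *)
Lemma laplace_transform_inj d1 (O1 : measurableType d1) (P1 : probability O1 R)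
    d2 (O2 : measurableType d2) (P2 : probability O2 R)
    (X1 : {RV P1 >-> R}) (X2 : {RV P2 >-> R}) :
  {ae P1, forall w, 0 <= X1 w} -> {ae P2, forall w, 0 <= X2 w} ->
  (forall u, 0 <= u -> laplace_transform P1 X1 u = laplace_transform P2 X2 u) ->
  eq_in_law P1 P2 X1 X2.
Proof.
move=> X1ge0 X2ge0 lap.
pose g (x : R) := expR (- Num.max 0 x).
have mg : measurable_fun setT g.
  apply: measurableT_comp => //; apply: measurable_funN.
  exact: measurable_maxr.
have g01 x : 0 <= g x <= 1.
  by rewrite expR_ge0 -[leRHS]expR0 ler_expR oppr_le0 le_max lexx.
have gmom d (O : measurableType d) (P : probability O R) (X : {RV P >-> R}) n :
    {ae P, forall w, 0 <= X w} ->
    (\int[P]_w (g (X w) ^+ n))%:E = laplace_transform P X n%:R.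
  move=> X0; rewrite laplace_transform_pos//; congr EFin.
  by apply: eq_Rintegral => w _; rewrite /g -expRM_natl mulrN.
have mlnA (A : set R) : measurable A -> measurable ((fun y => - ln y) @^-1` A).
  move=> mA; rewrite -[X in measurable X]setTI.
  exact: (measurable_funN (measurable_ln (R := R))).
have geq d (O : measurableType d) (P : probability O R) (X : {RV P >-> R}) A :
    {ae P, forall w, 0 <= X w} -> measurable A ->
    P (X @^-1` A) = P ((g \o X) @^-1` ((fun y => - ln y) @^-1` A)).
  move=> X0 mA; apply: eq_measure_ae.
  - exact: measurable_funPTI.
  - rewrite -[X in measurable X]setTI.
    by apply: (measurableT_comp mg (measurable_funPT X)) => //; exact: mlnA.
  - apply: filterS X0 => w Xw /=.
    by rewrite /g max_r// expRK opprK.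
move=> A mA; rewrite /pushforward.
rewrite (geq _ _ _ _ _ X1ge0 mA) (geq _ _ _ _ _ X2ge0 mA).
pose mk d (O : measurableType d) (P : probability O R) (X : {RV P >-> R}) :=
  isMeasurableFun.Build _ _ _ _ (g \o X)
    (measurableT_comp mg (measurable_funPT X)).
pose Y1 : {RV P1 >-> R} := HB.pack (g \o X1) (mk _ _ _ X1).
pose Y2 : {RV P2 >-> R} := HB.pack (g \o X2) (mk _ _ _ X2).
apply: (@moments_inj _ _ _ _ _ _ Y1 Y2).
- by move=> w; exact: g01.
- by move=> w; exact: g01.
- by move=> n; apply: EFin_inj; rewrite !gmom// lap.
- exact: mlnA.
Qed.

End MomentProblem.

(** * Laplace transform of the product of S with the power 1/alpha of W *)

Section StableMixture.
Context {R : realType} d (O : measurableType d) (P : probability O R).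
Implicit Types W S X Y : {RV P >-> R}.

Definition pair_RV X Y (w : O) : R * R := (X w, Y w).

HB.instance Definition _ X Y := isMeasurableFun.Build _ _ _ _ (pair_RV X Y)
  (measurable_fun_pair (measurable_funPT X) (measurable_funPT Y)).

(** Independence makes the joint law agree with the product measure on rectangles, hence on all
    measurable sets; Tonelli's theorem then gives the iterated integral. *)
Lemma independent_integral X Y (f : R * R -> \bar R) : independent_RV X Y ->
  measurable_fun setT f -> (forall z, 0 <= f z)%E ->
  (\int[P]_w f (X w, Y w) =
   \int[distribution P X]_x \int[distribution P Y]_y f (x, y))%E.
Proof.
move=> XY mf f0.
rewrite -(@fubini_tonelli1 _ _ _ _ _ (distribution P X) (distribution P Y) f)//.
rewrite (@eq_measure_integral _ _ _ setT (distribution P (pair_RV X Y))).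
  by rewrite ge0_integral_distribution.
move=> A mA _; by apply: product_measure_unique mA => B C; exact: XY.
Qed.

Lemma ae_distribution X (A : set R) : measurable A ->
  {ae P, forall w, A (X w)} -> {ae distribution P X, forall x, A x}.
Proof.
move=> mA AX; exists (~` A); split => //; first exact: measurableC.
rewrite -[LHS]/(P (X @^-1` (~` A))).
exact: measure_negligible (measurable_funPTI X (measurableC mA)) AX.
Qed.

(** Given W = x, the transform of [S] is evaluated at u x^(1/alpha), and raising this to the power
    [alpha] leaves the exponent linear in x. *)
Lemma laplace_transform_stable_mixture W S (alpha u : R) :
  0 < alpha -> 0 <= u ->
  {ae P, forall w, 0 <= W w} -> positive_stable S alpha -> independent_RV W S ->
  laplace_transform P (fun w => W w `^ alpha^-1 * S w) u =
  laplace_transform P W (u `^ alpha).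
Proof.
move=> a0 u0 W0 [_ Slap] WS.
pose f (z : R * R) := (expR (- (u * (z.1 `^ alpha^-1 * z.2))))%:E.
have mf : measurable_fun setT f.
  apply/measurable_EFinP; apply: measurableT_comp => //.
  apply: measurable_funN; apply: measurable_funM => //.
  apply: measurable_funM; last exact: measurable_snd.
  by apply: (measurableT_comp (measurable_powR _)); exact: measurable_fst.
have mg (c : R) : measurable_fun setT (fun x => (expR (- (c * x)))%:E).
  apply/measurable_EFinP; apply: measurableT_comp => //.
  by apply: measurable_funN; exact: measurable_funM.
have lapE X c :
    (\int[distribution P X]_x (expR (- (c * x)))%:E =
     'E_P[fun w => expR (- (c * X w))])%E.
  by rewrite ge0_integral_distribution ?unlock// => x; rewrite lee_fin expR_ge0.
rewrite /laplace_transform -lapE unlock.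
have f_ge0 z : (0 <= f z)%E by rewrite lee_fin expR_ge0.
rewrite (@independent_integral W S f)//.
apply: ge0_ae_eq_integral => //.
- exact: (@measurable_fun_fubini_tonelli_F _ _ _ _ _ (distribution P S) f).
- by move=> x _; apply: integral_ge0 => y _.
(* The exponents [alpha^-1] and [alpha] cancel only for [0 <= x], which holds for almost every [x]
   under the law of [W]. *)
have : {ae distribution P W, forall x, 0 <= x}.
  apply: (@ae_distribution _ [set x | 0 <= x]) => //.
  by rewrite -set_itvcy.
apply: filterS => x x0 _.
have := Slap (u * x `^ alpha^-1); rewrite mulr_ge0 ?powR_ge0// => /(_ isT).
rewrite powRM ?powR_ge0// -powRrM mulVf ?gt_eqF// powRr1// => <-.
rewrite /laplace_transform -lapE.
by apply: eq_integral => y _; rewrite /f /= mulrA.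
Qed.

End StableMixture.

(** * Riemann sums for a sub-Markov semigroup and their limit *)

Lemma cvg_to_eq {I : Type} {V : topologicalType} (F : set_system I)
  (f : I -> V) (l l' : V) : l = l' -> f @ F --> l -> f @ F --> l'.
Proof. by move=> ->. Qed.

(** With [G t = P(W > t)], the upper Riemann sum of [E (expR (- (s * W)))] over
    the grid [0, h, ..., N h]. *)
Definition discounted_loss {R : realType} (G : R -> R) (s h : R) N : R :=
  \sum_(k < N) expR (- (s * (k%:R * h))) *
    (G (k%:R * h) - G (k.+1%:R * h)).

Section SubMarkovSemigroup.
Context {R : realType} {p : nat}.

(** Abstracts the transition probabilities among the transient states; their row sums fall short of
    1 by the probability of absorption. *)
Record sub_markov_semigroup (U : R -> 'M[R]_p) (T : 'M[R]_p) : Prop := {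
  sub_markov_ge0 : forall (t : R) i j, 0 <= t -> 0 <= U t i j;
  sub_markov_le1 : forall (t : R) i, 0 <= t -> \sum_j U t i j <= 1;
  sub_markov0 : U 0 = 1%:M;
  sub_markovD : forall s t : R, 0 <= s -> 0 <= t -> U (s + t) = U s *m U t;
  sub_markov_generator : forall i j,
    h^-1 * (U h i j - (1%:M : 'M[R]_p) i j) @[h --> 0^'+] --> T i j
}.

Definition survival (pi : 'rV[R]_p) (U : R -> 'M[R]_p) (t : R) : R :=
  (pi *m U t *m (const_mx 1 : 'cV_p)) 0 0.

Lemma mulmx_row_col_bound (r : 'rV[R]_p) (v : 'cV[R]_p) (D : R) :
  (forall i, 0 <= r 0 i) -> (forall i, `|v i 0| <= D) ->
  `|(r *m v) 0 0| <= (\sum_i r 0 i) * D.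
Proof.
move=> r0 vD; rewrite mxE mulr_suml (le_trans (ler_norm_sum _ _ _))//.
by apply: ler_sum => i _; rewrite normrM ger0_norm// ler_wpM2l.
Qed.

(** Take a kernel vector and a row [i] where its modulus is largest: the diagonal term is opposite
    to the sum of the others, which forces the row sum times this modulus to be at most 0. *)
Lemma diagonal_dominant_unitmx (B : 'M[R]_p) :
  (forall i j, i != j -> B i j <= 0) -> (forall i, 0 < \sum_j B i j) ->
  B \in unitmx.
Proof.
(* Transposing turns the left kernel tested by [row_free] into the right kernel of [B], for which
   row sums are the relevant ones. *)
move=> Boff Brow; rewrite -unitmx_tr -row_free_unit.
apply: inj_row_free => v vB; apply/eqP; apply: contraT => /eqP v_neq0.
have [k vk] : exists k, v 0 k != 0.
  apply: contrapT => v0; apply: v_neq0; apply/rowP => j; rewrite mxE.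
  by apply/eqP; apply: contra_notT v0 => ?; exists j.
case: (@arg_maxP _ _ _ k xpredT (fun j => `|v 0 j|)) => // i _ vmax.
have vi0 : 0 < `|v 0 i| by rewrite (lt_le_trans _ (vmax k isT))// normr_gt0.
have vBi : \sum_j v 0 j * B i j = 0.
  have := congr1 (fun u : 'rV[R]_p => u 0 i) vB.
  rewrite !mxE => H; rewrite -[RHS]H.
  by apply: eq_bigr => j _; rewrite mxE.
have : (\sum_j B i j) * `|v 0 i| <= 0.
  rewrite (bigD1 i)//= in vBi; rewrite (bigD1 i)//= mulrDl.
  rewrite -lerBrDr sub0r mulr_suml -sumrN.
  apply: (@le_trans _ _ `|B i i * v 0 i|).
    by rewrite normrM ler_wpM2r// ler_norm.
  rewrite mulrC; move/eqP: vBi; rewrite addr_eq0 => /eqP ->; rewrite normrN.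
  rewrite (le_trans (ler_norm_sum _ _ _))//; apply: ler_sum => j ji.
  rewrite normrM mulrC -mulNr ler0_norm ?Boff 1?eq_sym//.
  by rewrite ler_wpM2l ?oppr_ge0 ?Boff 1?eq_sym//; exact: vmax.
by rewrite pmulr_lle0// leNgt Brow.
Qed.

Context (pi : 'rV[R]_p) (T : 'M[R]_p) (U : R -> 'M[R]_p).
Context (pi_ge0 : forall i, 0 <= pi 0 i) (pi_sum1 : \sum_i pi 0 i = 1).
Context (subU : sub_markov_semigroup U T).

Lemma sub_markov_row_ge0 t i : 0 <= t -> 0 <= (pi *m U t) 0 i.
Proof.
move=> t0; rewrite mxE sumr_ge0// => j _.
by rewrite mulr_ge0// (sub_markov_ge0 subU).
Qed.

Lemma survivalE t : survival pi U t = \sum_i (pi *m U t) 0 i.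
Proof. by rewrite /survival mxE; apply: eq_bigr => i _; rewrite !mxE mulr1. Qed.

Lemma survival_le1 t : 0 <= t -> survival pi U t <= 1.
Proof.
move=> t0; rewrite survivalE.
under eq_bigr do rewrite mxE.
rewrite exchange_big -pi_sum1 /=; apply: ler_sum => i _.
by rewrite -mulr_sumr ler_piMr// (sub_markov_le1 subU).
Qed.

(** Divided by [h], this tends to [t - (s I - T) c] as [h] decreases to 0. *)
Definition euler_defect (s h : R) (c : 'cV[R]_p) : 'cV[R]_p :=
  (const_mx 1 - U h *m const_mx 1) - (c - expR (- (s * h)) *: (U h *m c)).

(** With [q = expR (- (s * h))] and [y k = q ^+ k * pi U(k h) c], the [k]-th term is [y k - y k.+1]
    plus [q ^+ k * pi U(k h) d]. The first part telescopes. As [pi U(k h)] is nonnegative of total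
    mass at most 1, the second is at most [D * q ^+ k]. *)
Lemma discounted_lossE (s h : R) (c : 'cV[R]_p) (D : R) N :
  0 < s -> 0 < h -> 0 <= D ->
  (forall i, `|euler_defect s h c i 0| <= D) ->
  `|discounted_loss (survival pi U) s h N -
    ((pi *m c) 0 0 - expR (- (s * (N%:R * h))) * (pi *m U (N%:R * h) *m c) 0 0)|
  <= D / (1 - expR (- (s * h))).
Proof.
move=> s0 h0 D0; set d := euler_defect s h c => dD.
pose q := expR (- (s * h)).
have q1 : q < 1 by rewrite expR_lt1 oppr_lt0 mulr_gt0.
pose y k := expR (- (s * (k%:R * h))) * (pi *m U (k%:R * h) *m c) 0 0.
have kh0 (k : nat) : 0 <= k%:R * h by rewrite mulr_ge0// ltW.
have qk (k : nat) : expR (- (s * (k%:R * h))) = q ^+ k.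
  by rewrite /q -expRM_natl; congr expR; ring.
have US (k : nat) : U (k.+1%:R * h) = U (k%:R * h) *m U h.
  by rewrite -natr1 mulrDl mul1r (sub_markovD subU)// ltW.
have y0 : y 0%N = (pi *m c) 0 0.
  by rewrite /y !mul0r mulr0 oppr0 expR0 mul1r (sub_markov0 subU) mulmx1.
have step (k : nat) : expR (- (s * (k%:R * h))) *
    (survival pi U (k%:R * h) - survival pi U (k.+1%:R * h)) - (y k - y k.+1) =
    q ^+ k * (pi *m U (k%:R * h) *m d) 0 0.
  rewrite /y !qk /survival US exprS /d /euler_defect -/q.
  rewrite !mulmxBr -!scalemxAr !mulmxA !mxE; ring.
have -> : discounted_loss (survival pi U) s h N - ((pi *m c) 0 0 - y N) =
    \sum_(k < N) q ^+ k * (pi *m U (k%:R * h) *m d) 0 0.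
  rewrite -y0 -[y 0%N - _]opprB -telescope_sumr// big_mkord -sumrN -sumrB.
  by apply: eq_bigr => k _; rewrite -step opprB.
have q0 : 0 <= q := expR_ge0 _.
rewrite (le_trans (ler_norm_sum _ _ _))//.
apply: (@le_trans _ _ (\sum_(k < N) D * q ^+ k)).
  apply: ler_sum => k _; rewrite normrM ger0_norm ?exprn_ge0// mulrC.
  apply: ler_wpM2r; first exact: exprn_ge0.
  rewrite (le_trans (mulmx_row_col_bound _ dD))//.
    by move=> i; exact: sub_markov_row_ge0.
  by rewrite -survivalE ler_piMl// survival_le1.
(* Geometric sum: multiplied by [1 - q] it becomes [1 - q ^+ N], which is at most 1. *)
rewrite -mulr_sumr ler_wpM2l// -[leRHS]mul1r ler_pdivlMr ?subr_gt0//.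
rewrite mulrC -opprB mulNr -subrX1 opprB lerBlDr lerDl.
exact: exprn_ge0.
Qed.

Lemma survival0 : survival pi U 0 = 1.
Proof.
rewrite survivalE -pi_sum1; apply: eq_bigr => i _.
by rewrite (sub_markov0 subU) mulmx1.
Qed.

Lemma cvg_expRN_natS (s : R) : 0 < s ->
  expR (- (s * n.+1%:R)) @[n --> \oo] --> 0.
Proof.
move=> s0; under eq_cvg do rewrite -mulNr expRM_natr exprSr.
apply: (@cvg_to_eq _ _ _ _ (0 * expR (- s))); first by rewrite mul0r.
apply: cvgM; last exact: cvg_cst.
by apply: cvg_expr; rewrite ger0_norm ?expR_ge0// expR_lt1 oppr_lt0.
Qed.

(** The inequality [1 + x <= expR x], at [x = s * h] and at [x = - (s * h)], squeezes the quotient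
    between [s / (1 + s * h)] and [s]. *)
Lemma cvg_expR_quotient (s : R) : 0 < s ->
  h^-1 * (1 - expR (- (s * h))) @[h --> 0^'+] --> s.
Proof.
move=> s0; apply: (squeeze_cvgr (f := fun h => s / (1 + s * h)) (h := cst s)).
- near=> h.
  have h0 : 0 < h by [].
  have sh0 : 0 < s * h by rewrite mulr_gt0.
  rewrite [h^-1 * _]mulrC; apply/andP; split.
    rewrite ler_pdivlMr//.
    have -> : s / (1 + s * h) * h = 1 - (1 + s * h)^-1.
      by field; rewrite gt_eqF// addr_gt0.
    rewrite lerD2l lerN2 expRN lef_pV2 ?posrE ?addr_gt0 ?expR_gt0//.
    exact: expR_ge1Dx.
  rewrite ler_pdivrMr//= lerBlDl -lerBlDr; exact: expR_ge1Dx.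
- rewrite -[X in _ --> X](divr1 s); apply: cvgM; first exact: cvg_cst.
  apply: cvgV => //; rewrite -[X in _ --> X](addr0 1) -[X in 1 + X](mulr0 s).
  apply: cvgD; first exact: cvg_cst.
  by apply: cvgM; [exact: cvg_cst|exact: cvg_at_right_filter cvg_id].
- exact: cvg_cst.
Unshelve. all: by end_near.
Qed.

Lemma sub_markov_generator_mulmx (c : 'cV[R]_p) i :
  h^-1 * ((U h *m c) i 0 - c i 0) @[h --> 0^'+] --> (T *m c) i 0.
Proof.
have E h : h^-1 * ((U h *m c) i 0 - c i 0) =
    \sum_j h^-1 * (U h i j - (1%:M : 'M[R]_p) i j) * c j 0.
  have -> : c i 0 = (1%:M *m c) i 0 by rewrite mul1mx.
  rewrite [(U h *m c) i 0]mxE [(1%:M *m c) i 0]mxE -sumrB mulr_sumr.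
  by apply: eq_bigr => j _; ring.
rewrite (eq_cvg _ _ E).
rewrite mxE; apply: cvg_big => [|j _]; first exact: add_continuous.
exact: cvgM (sub_markov_generator subU (i:=i) (j:=j)) (cvg_cst _).
Qed.

(** The quotient splits into difference quotients of [U] at the vector e of ones and at [c], and of
    the exponential. Their limits add up to - T e + T c - s c, which the equation for [c] makes
    0. *)
Lemma cvg_euler_defect (s : R) (c : 'cV[R]_p) i : 0 < s ->
  (s%:M - T) *m c = exit_rates T ->
  h^-1 * euler_defect s h c i 0 @[h --> 0^'+] --> 0.
Proof.
move=> s0 cE.
have E h : h^-1 * euler_defect s h c i 0 =
    - (h^-1 * ((U h *m (const_mx 1 : 'cV[R]_p)) i 0 -
               (const_mx 1 : 'cV[R]_p) i 0)) +
    expR (- (s * h)) * (h^-1 * ((U h *m c) i 0 - c i 0)) -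
    h^-1 * (1 - expR (- (s * h))) * c i 0.
  rewrite /euler_defect; move: (U h *m const_mx 1) (U h *m c) => X Y.
  by rewrite !mxE; ring.
rewrite (eq_cvg _ _ E).
have L0 : 0 = - (T *m (const_mx 1 : 'cV[R]_p)) i 0 + 1 * (T *m c) i 0 -
    s * c i 0.
  have := congr1 (fun v : 'cV[R]_p => v i 0) cE.
  rewrite mulmxBl mul_scalar_mx /exit_rates => H.
  have : s * c i 0 - (T *m c) i 0 = - (T *m (const_mx 1 : 'cV[R]_p)) i 0.
    by move: H; rewrite !mxE.
  by move=> <-; ring.
apply: (cvg_to_eq (esym L0)); apply: cvgB; last first.
  by apply: cvgM; [exact: cvg_expR_quotient|exact: cvg_cst].
apply: cvgD; first by apply: cvgN; exact: sub_markov_generator_mulmx.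
apply: cvgM; last exact: sub_markov_generator_mulmx.
have <- : expR (- (s * 0)) = 1 by rewrite mulr0 oppr0 expR0.
apply: continuous_cvg; first exact: continuous_expR.
apply: cvgN; apply: cvgM; first exact: cvg_cst.
exact: cvg_at_right_filter cvg_id.
Qed.

(** With mesh 1/(n+1) and (n+1)^2 cells the grid covers [0, n+1]: the mesh tends to 0, which kills
    the defect, while the horizon tends to infinity, which kills the boundary term. *)
Lemma cvg_discounted_loss (s : R) (c : 'cV[R]_p) : 0 < s ->
  (s%:M - T) *m c = exit_rates T ->
  discounted_loss (survival pi U) s (harmonic n) (n.+1 ^ 2) @[n --> \oo] -->
  (pi *m c) 0 0.
Proof.
move=> s0 cE.
pose C := \sum_i `|c i 0|.
have C_ge i : `|c i 0| <= C by rewrite /C (bigD1 i)//= lerDl sumr_ge0.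
pose D h := \sum_i `|h^-1 * euler_defect s h c i 0|.
have D_ge h i : 0 < h -> `|euler_defect s h c i 0| <= h * D h.
  move=> h0; rewrite /D (bigD1 i)//= mulrDr normrM gtr0_norm ?invr_gt0//.
  by rewrite mulVKf ?gt_eqF// lerDl mulr_ge0 ?sumr_ge0// ltW.
have D0 : D h @[h --> 0^'+] --> 0.
  apply: (@cvg_to_eq _ _ _ _ (\sum_(i < p) `|0 : R|)).
    by rewrite big1// => i _; rewrite normr0.
  apply: cvg_big => [|i _]; first exact: add_continuous.
  by apply: cvg_norm; exact: cvg_euler_defect.
have har : (forall n, 0 < @harmonic R n) /\ (@harmonic R n @[n --> \oo] --> 0).
  by split; [exact: harmonic_gt0|exact: cvg_harmonic].
(* In [e], the first summand is the defect error [h * D h / (1 - expR (- (s * h)))], rewritten so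
   that [q h] tends to [s^-1]; the second bounds the boundary term at time [n.+1%:R]. *)
pose q h := (h^-1 * (1 - expR (- (s * h))))^-1.
pose e n := D (harmonic n) * q (harmonic n) + expR (- (s * n.+1%:R)) * C.
have e0 : e n @[n --> \oo] --> 0.
  apply: (@cvg_to_eq _ _ _ _ (0 * s^-1 + 0 * C)); first by rewrite !mul0r addr0.
  apply: cvgD.
    apply: cvgM; first by move/cvg_at_rightP: D0; apply.
    apply: cvgV; first by rewrite gt_eqF.
    by have /cvg_at_rightP := cvg_expR_quotient s0; apply.
  apply: cvgM; last exact: cvg_cst.
  exact: cvg_expRN_natS.
pose loss h n := discounted_loss (survival pi U) s h (n.+1 ^ 2).
have bnd n : `|loss (harmonic n) n - (pi *m c) 0 0| <= e n.
  have h0 := har.1 n; set h := harmonic n in h0 *.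
  have Dh0 : 0 <= h * D h by rewrite mulr_ge0 ?sumr_ge0// ltW.
  have := discounted_lossE (n.+1 ^ 2) s0 h0 Dh0 (fun i => D_ge h i h0).
  have Nh : (n.+1 ^ 2)%:R * h = n.+1%:R.
    by rewrite /h natrX expr2 -mulrA mulfV ?mulr1.
  rewrite Nh => H.
  set y := _ * (pi *m _ *m c) 0 0 in H.
  have -> : loss h n - (pi *m c) 0 0 = loss h n - ((pi *m c) 0 0 - y) - y.
    by ring.
  rewrite (le_trans (ler_normB _ _))// /e; apply: lerD.
    by apply: le_trans H _; rewrite /q invfM invrK mulrCA mulrA.
  rewrite normrM ger0_norm ?expR_ge0// ler_wpM2l ?expR_ge0//.
  have U0 : (0 : R) <= n.+1%:R by [].
  rewrite (le_trans (mulmx_row_col_bound _ C_ge))//.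
    by move=> i; exact: sub_markov_row_ge0.
  by rewrite -survivalE ler_piMl// ?survival_le1// /C sumr_ge0.
apply/cvgrPdist_le => eps eps0; near=> n.
rewrite distrC (le_trans (bnd n))// (le_trans (ler_norm _))//.
by near: n; move/cvgr0_norm_le : e0; apply.
Unshelve. all: by end_near.
Qed.

End SubMarkovSemigroup.

(** * States with zero exit rate are absorbing *)

Section TransitionSemigroup.
Context {R : realType} {n : nat}.
Implicit Types (Pt : R -> 'M[R]_n) (L : 'M[R]_n).

Lemma transition_le1 Pt L t i j : transition_semigroup Pt L -> 0 <= t ->
  Pt t i j <= 1.
Proof.
move=> sg t0; rewrite -(transition_sum1 sg i t0) (bigD1 j)//= lerDl sumr_ge0//.
by move=> k _; exact: (transition_ge0 sg).
Qed.

Lemma bernoulli_le (x : R) m : 0 <= x <= 1 -> 1 - m%:R * (1 - x) <= x ^+ m.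
Proof.
move=> /andP[x0 x1]; elim: m => [|m IH]; first by rewrite mul0r subr0 expr0.
rewrite exprS (le_trans _ (ler_wpM2l x0 IH))// -natr1.
have : 0 <= m%:R * (1 - x) ^+ 2 by rewrite mulr_ge0 ?sqr_ge0.
by move: m%:R => r; nra.
Qed.

(** Among the ways to go from [j] to [j] in [m] steps of length [t], keep only the one that is in
    [j] at every step. *)
Lemma transition_diag_expn Pt L t j m : transition_semigroup Pt L -> 0 <= t ->
  Pt t j j ^+ m <= Pt (m%:R * t) j j.
Proof.
move=> sg t0; elim: m => [|m IH].
  by rewrite mul0r (transition0 sg) mxE eqxx expr0.
have mt0 : 0 <= m%:R * t by rewrite mulr_ge0.
rewrite exprSr -natr1 mulrDl mul1r (transitionD sg)// mxE (bigD1 j)//=.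
rewrite ler_wpDr//; last by rewrite ler_wpM2r// (transition_ge0 sg).
by rewrite sumr_ge0// => k _; rewrite mulr_ge0// (transition_ge0 sg).
Qed.

(** Cut [[0, t]] into [m.+1] steps of length [h]. As [L j j = 0], each step leaves [j] with
    probability o(h), and by Bernoulli's inequality the total loss is at most [m.+1] times that,
    which is arbitrarily small. *)
Lemma transition_absorbing Pt L j t : transition_semigroup Pt L ->
  L j j = 0 -> 0 <= t -> Pt t j j = 1.
Proof.
move=> sg Ljj; rewrite le_eqVlt => /predU1P[<-|t0].
  by rewrite (transition0 sg) mxE eqxx.
apply/eqP; rewrite eq_le (transition_le1 _ _ sg (ltW t0))/=.
apply/ler_addgt0Pl => e e0.
have := transition_intensity sg (i := j) (j := j); rewrite Ljj mxE eqxx /=.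
move/cvg_at_rightP => /(_ (fun m => t * harmonic m)) H.
have /H : (forall m, 0 < t * @harmonic R m) /\
    (t * @harmonic R m @[m --> \oo] --> 0).
  split=> [m|]; first by rewrite mulr_gt0 ?harmonic_gt0.
  apply: (@cvg_to_eq _ _ _ _ (t * 0)); first by rewrite mulr0.
  by apply: cvgM; [exact: cvg_cst|exact: cvg_harmonic].
(* With tolerance [e / t], the [m.+1] steps of length [h = t / m.+1%:R] lose at most
   [m.+1%:R * h * (e / t) = e]. *)
move/cvgr0_norm_le => /(_ (e / t) (divr_gt0 e0 t0)) [m _ /(_ m (leqnn m))] /=.
set h := t * _; set g := Pt h j j => hg.
have h0 : 0 < h by rewrite mulr_gt0 ?harmonic_gt0.
have th : t = m.+1%:R * h by rewrite /h mulrCA mulfV ?mulr1.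
have := transition_diag_expn j m.+1 sg (ltW h0); rewrite -th -/g => gt.
rewrite -lerBlDl; apply: le_trans gt.
have g01 : 0 <= g <= 1.
  rewrite /g (transition_ge0 sg _ _ (ltW h0)).
  exact: transition_le1 sg (ltW h0).
apply: le_trans (bernoulli_le _ g01).
rewrite lerD2l lerN2; have g1 : 0 <= 1 - g by rewrite subr_ge0; case/andP: g01.
move: hg; rewrite normrM gtr0_norm ?invr_gt0// distrC ger0_norm//.
rewrite ler_pdivrMl// => hg.
rewrite (le_trans (ler_wpM2l _ hg))//.
by rewrite mulrA -th mulrC divfK ?gt_eqF.
Qed.

End TransitionSemigroup.

(** * Marginals of a Markov jump process and hitting time of an absorbing state *)

Section JumpProcessMarginals.
Context {R : realType} {n : nat}.
Context d (O : measurableType d) (Q : probability O R).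
Context (Y : R -> O -> 'I_n) (nu : 'rV[R]_n) (L : 'M[R]_n).
Context (YP : markov_jump_process Q Y nu L).
Context (Pt : R -> 'M[R]_n).
Context (PtE : forall (m : nat) (t : nat -> R) (i : nat -> 'I_n) (s : R) j,
  0 <= t 0%N -> (forall k, t k <= t k.+1) -> 0 <= s ->
  let past := \bigcap_(k in `I_m.+1) [set w | Y (t k) w = i k] in
  Q (past `&` [set w | Y (t m + s) w = j]) = (Q past * (Pt s (i m) j)%:E)%E).

Lemma jump_two_times q s i j : 0 <= q -> 0 <= s ->
  Q ([set w | Y q w = i] `&` [set w | Y (q + s) w = j]) =
  (Q [set w | Y q w = i] * (Pt s i j)%:E)%E.
Proof.
move=> q0 s0; have := PtE 0 (fun=> i) j q0 (fun=> lexx q) s0.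
by rewrite /= II1 bigcap_set1.
Qed.

Lemma jump_marginal t j : 0 <= t ->
  Q [set w | Y t w = j] = ((nu *m Pt t) 0 j)%:E.
Proof.
move=> t0.
(* Split according to the state at time 0; [t] is written [0 + t] to fit the two-time Markov
   property. *)
have -> : [set w | Y t w = j] =
    \big[setU/set0]_(i < n) ([set w | Y 0 w = i] `&` [set w | Y (0 + t) w = j]).
  rewrite -bigcup_seq add0r.
  apply/seteqP; split => [w Yw|w [i _ []]//].
  by exists (Y 0 w); rewrite //= mem_index_enum.
rewrite measure_bigsetU_ord//=.
- rewrite mxE -sumEFin; apply: eq_bigr => i _.
  by rewrite jump_two_times// (jump_init YP).
- move=> i; apply: measurableI; first exact: (jump_measurable YP).
  by apply: (jump_measurable YP); rewrite add0r.
- by move=> i k _ _ [w [[<- _] [<- _]]].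
Qed.

(** Since [Pt (t - q) a a = 1], the event of being in [a] at both times has the same probability as
    being there at time [q]. *)
Lemma jump_absorbing a q t : transition_semigroup Pt L -> L a a = 0 ->
  0 <= q <= t -> {ae Q, forall w, Y q w = a -> Y t w = a}.
Proof.
move=> sg La /andP[q0 qt].
have t0 : 0 <= t by exact: le_trans qt.
have mq := jump_measurable YP a q0; have mt := jump_measurable YP a t0.
exists ([set w | Y q w = a] `\` [set w | Y t w = a]); split.
- exact: measurableD.
- rewrite measureD//=; last by rewrite -ge0_fin_numE// fin_num_measure.
  have := @jump_two_times q (t - q) a a q0; rewrite subr_ge0 => /(_ qt).
  rewrite subrKC (transition_absorbing sg La) ?subr_ge0// mule1 => ->.
  by rewrite subee// fin_num_measure.
- by move=> w /= /not_implyP.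
Qed.

(** A right-continuous path with discrete values attains its hitting time and then stays in [a] for
    a while, hence up to some rational time. This turns the event into a countable union of events
    at fixed times. *)
Lemma hitting_time_leP (a : 'I_n) (t : R) w : 0 <= t ->
  (EFin @` `]-oo, t]) (hitting_time Y a w) <->
  (exists q : rat, 0 <= (ratr q : R) <= t /\ Y (ratr q) w = a) \/ Y t w = a.
Proof.
move=> t0; set S := [set t%:E | t in [set t : R | 0 <= t /\ Y t w = a]].
have inf0 : (0%:E <= ereal_inf S)%E.
  by apply/ereal_infP => _ [s [s0 _] <-]; rewrite lee_fin.
split=> [[r /=]|]; last first.
  have attained s : 0 <= s <= t -> Y s w = a ->
      (EFin @` `]-oo, t]) (hitting_time Y a w).
    move=> /andP[s0 st] Ys.
    have infs : (ereal_inf S <= s%:E)%E by apply: ereal_inf_lbound; exists s.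
    have Hfin : ereal_inf S \is a fin_num.
      by rewrite (ge0_fin_numE inf0) (le_lt_trans infs) ?ltey.
    exists (fine (ereal_inf S)); last by rewrite fineK.
    by rewrite /= in_itv/= -lee_fin fineK// (le_trans infs)// lee_fin.
  case=> [[q [qt Yq]]|Yt]; first exact: attained qt Yq.
  by apply: (attained t) => //; rewrite t0 lexx.
rewrite in_itv/= => rt Hr; rewrite /hitting_time -/S in Hr.
have r0 : 0 <= r by rewrite -lee_fin Hr.
have [e /= e0 Ye] := jump_right_continuous YP w r0.
have Yr_near s : r < s -> s < r + e -> Y s w = Y r w.
  move=> rs se; apply: Ye => //=.
  by rewrite ltr0_norm ?subr_lt0// opprB ltrBlDl.
(* The infimum [r] is attained: some visit to [a] lies in [[r, r + e[], where the path keeps its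
   value at [r]. *)
have Yr : Y r w = a.
  have /ereal_inf_lt[_ [s [s0 Ys] <-]] : (ereal_inf S < (r + e)%:E)%E.
    by rewrite -Hr lte_fin ltrDl.
  rewrite lte_fin => se.
  have : r <= s by rewrite -lee_fin Hr; apply: ereal_inf_lbound; exists s.
  by rewrite le_eqVlt => /predU1P[->//|rs]; rewrite -(Yr_near s).
(* If [r = t], there may be no rational in [[r, t]]; the second alternative covers this case. *)
move: rt; rewrite le_eqVlt => /predU1P[<-|rt]; [by right|left].
have /rat_in_itvoo[q] : r < Num.min t (r + e) by rewrite lt_min rt ltrDl.
rewrite in_itv/= lt_min => /and3P[rq qt qe]; exists q.
by rewrite (le_trans r0 (ltW rq)) (ltW qt) Yr_near.
Qed.

(** As [a] is absorbing, having visited it by time [t] is almost surely the same as being there at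
    time [t]; with rational visiting times only countably many null sets are discarded. *)
Lemma hitting_time_cdf (a : 'I_n) t : transition_semigroup Pt L -> L a a = 0 ->
  0 <= t ->
  Q [set w | (EFin @` `]-oo, t]) (hitting_time Y a w)] = ((nu *m Pt t) 0 a)%:E.
Proof.
move=> sg La t0; rewrite -jump_marginal//; apply: eq_measure_ae.
- have -> : [set w | (EFin @` `]-oo, t]) (hitting_time Y a w)] =
      (\bigcup_q [set w | 0 <= (ratr q : R) <= t /\ Y (ratr q) w = a]) `|`
      [set w | Y t w = a].
    apply/seteqP; split => w /=.
      by move/(hitting_time_leP _ _ t0) => [[q ?]|]; [left; exists q|right].
    move=> H; apply/(hitting_time_leP _ _ t0).
    by case: H => [[q _ ?]|]; [left; exists q|right].
  apply: measurableU; last exact: (jump_measurable YP).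
  apply: bigcupT_measurable_rat => q.
  have [/andP[q0 qt]|] := boolP (0 <= (ratr q : R) <= t).
    have -> : [set w | true /\ Y (ratr q) w = a] = [set w | Y (ratr q) w = a].
      by apply/seteqP; split => w //= [].
    exact: (jump_measurable YP).
  move=> _; rewrite (_ : [set w | _] = set0)//.
  by apply/seteqP; split => w //= [].
- exact: (jump_measurable YP).
(* Indexing the rationals by their codes [m] lets [ae_foralln] gather the null sets. *)
- have aeq (m : nat) : {ae Q, forall w, forall q, unpickle m = Some q ->
      0 <= (ratr q : R) <= t -> Y (ratr q) w = a -> Y t w = a}.
    case: (unpickle m) => [q|]; last by apply: aeW => w.
    have [qt|nqt] := boolP (0 <= (ratr q : R) <= t); last first.
      by apply: aeW => w q' [<-]; rewrite (negbTE nqt).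
    by apply: filterS (jump_absorbing sg La qt) => w H q' [<-] _; exact: H.
  apply: filterS (ae_foralln aeq) => w H.
  apply: (iff_trans (hitting_time_leP _ _ t0)); split; last by right.
  by case=> [[q [qt Yq]]|//]; apply: (H (pickle q) q) => //; rewrite pickleK.
Qed.

End JumpProcessMarginals.

(** * Survival function of a phase-type law *)

Section PhaseTypeLaw.
Context {R : realType} d (O : measurableType d) (P : probability O R).
Context {p : nat} (pi : 'rV[R]_p) (T : 'M[R]_p) (W : {RV P >-> R}).

Lemma absorbing_intensity :
  full_intensity T absorbing_state absorbing_state = 0.
Proof. by rewrite /full_intensity /absorbing_state block_mxEdr mxE. Qed.

(** The absorbing row has entry 1 at the absorbing state, hence 0 elsewhere. Paths through that
    state therefore contribute nothing to the upper left block of a product, and the block is itself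
    a semigroup. *)
Lemma transient_sub_markov (Pt : R -> 'M[R]_(p + 1)) :
  transition_semigroup Pt (full_intensity T) ->
  sub_markov_semigroup (fun t => ulsubmx (Pt t)) T.
Proof.
move=> sg.
have row_sum (t : R) i : 0 <= t ->
    \sum_j Pt t i (lshift 1 j) + Pt t i absorbing_state = 1.
  move=> t0; rewrite -(transition_sum1 sg i t0) big_split_ord /= big_ord1.
  by [].
have absj (t : R) j : 0 <= t -> Pt t absorbing_state (lshift 1 j) = 0.
  move=> t0; have := row_sum t absorbing_state t0.
  rewrite (transition_absorbing sg absorbing_intensity t0) => H.
  have S0 : \sum_j Pt t absorbing_state (lshift 1 j) = 0.
    by apply: (addIr 1); rewrite H add0r.
  by apply: (psumr_eq0P _ S0) => // k _; exact: (transition_ge0 sg).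
split.
- by move=> t i j t0; rewrite !mxE; exact: (transition_ge0 sg).
- move=> t i t0; under eq_bigr do rewrite !mxE.
  by rewrite -(row_sum t (lshift 1 i) t0) lerDl (transition_ge0 sg).
- rewrite (transition0 sg); apply/matrixP => i j.
  by rewrite !mxE (inj_eq (@lshift_inj _ _)).
- move=> s t s0 t0; rewrite (transitionD sg)//; apply/matrixP => i j.
  rewrite !mxE big_split_ord /= big_ord1 absj// mulr0 addr0.
  by apply: eq_bigr => k _; rewrite !mxE.
- move=> i j.
  have := transition_intensity sg (i := lshift 1 i) (j := lshift 1 j).
  rewrite /full_intensity block_mxEul; apply: cvg_trans; apply: near_eq_cvg.
  by near=> h; rewrite !mxE (inj_eq (@lshift_inj _ _)).
Unshelve. all: by end_near.
Qed.

(** Absorption by time [t] amounts to being in the last state at [t]. The initial law puts no mass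
    there and rows of [Pt t] sum to 1, so its probability is complementary to the mass left on the
    transient states. *)
Lemma PH_survival : PH_generator pi T -> PH_distributed W pi T ->
  exists2 U, sub_markov_semigroup U T &
    forall t, 0 <= t -> cdf W t = (1 - survival pi U t)%:E.
Proof.
move=> PH [d' [M [Q [Y [YP lawW]]]]].
have [Pt sg PtE] := jump_markov YP.
exists (fun t => ulsubmx (Pt t)); first exact: transient_sub_markov.
move=> t t0; rewrite /cdf lawW//.
rewrite (hitting_time_cdf YP PtE sg absorbing_intensity t0); congr EFin.
rewrite mxE big_split_ord /= big_ord1 row_mxEr mxE mul0r addr0.
rewrite -(PH_init_sum1 PH) /survival mxE.
under [X in _ - X]eq_bigr do rewrite [const_mx _ _ _]mxE mulr1 mxE.
rewrite exchange_big -sumrB /=; apply: eq_bigr => i _.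
rewrite row_mxEl -mulr_sumr -[X in X - _]mulr1 -mulrBr; congr (_ * _).
rewrite -(transition_sum1 sg (lshift 1 i) t0) big_split_ord /= big_ord1.
under [X in _ - X]eq_bigr do rewrite !mxE.
by rewrite addrC addrK.
Qed.

End PhaseTypeLaw.

(** * Riemann-sum bounds for a Laplace transform in terms of the distribution function *)

Section LaplaceRiemann.
Context {R : realType} d (O : measurableType d) (P : probability O R).
Context (W : {RV P >-> R}) (G : R -> R).
Context (G0 : G 0 = 1) (WG : forall t : R, 0 <= t -> cdf W t = (1 - G t)%:E).

(** Cell indicators are written as differences of indicators of half-lines, so that their integrals
    are differences of values of the distribution function. *)
Definition step_fun (h : R) N (a : nat -> R) (x : R) : R :=
  \sum_(k < N) a k * (\1_(`]-oo, k.+1%:R * h]) x - \1_(`]-oo, k%:R * h]) x).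

Lemma integrable_indic_diff (a x y : R) : P.-integrable setT
  (EFin \o (fun w => a * (\1_(`]-oo, x]) (W w) - \1_(`]-oo, y]) (W w)))).
Proof.
have := integrableB measurableT
  (integrable_indic_RV W (measurable_itv `]-oo, x]))
  (integrable_indic_RV W (measurable_itv `]-oo, y])).
exact: integrableZl.
Qed.

Lemma step_fun_integrable (h : R) N a :
  P.-integrable setT (EFin \o (fun w => step_fun h N a (W w))).
Proof.
apply: (eq_integrable measurableT (fun w => \sum_(k < N) (a k *
  (\1_(`]-oo, k.+1%:R * h]) (W w) - \1_(`]-oo, k%:R * h]) (W w)))%:E)%E).
  by move=> w _; rewrite sumEFin.
by apply: (integrable_sum measurableT) => k _; exact: integrable_indic_diff.
Qed.

Lemma Rintegral_indic_cdf t : 0 <= t ->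
  \int[P]_w (\1_(`]-oo, t]) (W w) : R) = 1 - G t.
Proof.
move=> t0; apply: EFin_inj; rewrite -WG// /cdf distribution_Rintegral//.
Qed.

Lemma Rintegral_step_fun (h : R) N a : 0 <= h ->
  \int[P]_w step_fun h N a (W w) =
  \sum_(k < N) a k * (G (k%:R * h) - G (k.+1%:R * h)).
Proof.
move=> h0; rewrite /step_fun Rintegral_sum; last first.
  by move=> k; exact: integrable_indic_diff.
apply: eq_bigr => k _; rewrite RintegralZl//; last first.
  have := integrable_indic_diff 1 (k.+1%:R * h) (k%:R * h).
  by apply: eq_integrable => // w _; rewrite /= mul1r.
rewrite RintegralB//; [|exact: integrable_indic_RV..].
rewrite !Rintegral_indic_cdf ?mulr_ge0//; ring.
Qed.

(** Cell indicators telescope to that of []0, N h]], so the middle term is a step function with all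
    coefficients [f x]. Off a cell its term vanishes in all three sums, so [f] is compared with [a]
    and [b] only on the cells. *)
Lemma step_fun_le (h : R) N (a b : nat -> R) (f : R -> R) x : 0 <= h ->
  (forall k, k%:R * h < x <= k.+1%:R * h -> a k <= f x <= b k) ->
  step_fun h N a x <= f x * (\1_(`]-oo, N%:R * h]) x - \1_(`]-oo, 0%R]) x)
    <= step_fun h N b x.
Proof.
move=> h0 ab.
pose I k : R := \1_(`]-oo, k%:R * h]) x.
have -> : f x * (\1_(`]-oo, N%:R * h]) x - \1_(`]-oo, 0%R]) x) =
    step_fun h N (fun=> f x) x.
  rewrite /step_fun -mulr_sumr; congr (_ * _).
  rewrite -(big_mkord xpredT (fun k => I k.+1 - I k)) telescope_sumr//.
  by rewrite /I mul0r.
have term k : a k * (\1_(`]-oo, k.+1%:R * h]) x - \1_(`]-oo, k%:R * h]) x) <=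
   f x * (\1_(`]-oo, k.+1%:R * h]) x - \1_(`]-oo, k%:R * h]) x) <=
   b k * (\1_(`]-oo, k.+1%:R * h]) x - \1_(`]-oo, k%:R * h]) x).
  rewrite !indicE !mem_setE !in_itv/=.
  have [xk|kx] := leP x (k%:R * h).
    have -> : x <= k.+1%:R * h.
      by rewrite (le_trans xk)// ler_wpM2r// ler_nat.
    by rewrite subrr !mulr0 lexx.
  have [xk1|] := leP x (k.+1%:R * h); last by rewrite subrr !mulr0 lexx.
  by rewrite subr0 !mulr1 ab// kx xk1.
by apply/andP; split; apply: ler_sum => k _; have /andP[] := term k.
Qed.

Lemma survival_RV_ge0 : {ae P, forall w, 0 <= W w}.
Proof.
exists (W @^-1` `]-oo, 0%R]); split; first exact: measurable_funPTI.
  by have := WG (lexx 0); rewrite G0 subrr.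
move=> w /= /negP W0; rewrite in_itv/=; apply: ltW.
by rewrite ltNge.
Qed.

(** On each cell the exponential lies between its values at the two endpoints, whose ratio is
    [expR (- (s * h))]; this factor turns the upper sum into the lower one. The added term of the
    upper bound covers the values of [W] beyond [N h]. *)
Lemma laplace_bounds (s h : R) N : 0 < s -> 0 < h ->
  expR (- (s * h)) * discounted_loss G s h N <= fine (laplace_transform P W s)
    <= discounted_loss G s h N + expR (- (s * (N%:R * h))).
Proof.
move=> s0 h0; set S := discounted_loss G s h N.
pose f x := expR (- (s * Num.max 0 x)).
have f0 x : 0 <= f x by exact: expR_ge0.
have intf : P.-integrable setT (EFin \o (fun w => f (W w))).
  exact: integrable_laplace_pos (ltW s0).
have -> : fine (laplace_transform P W s) = \int[P]_w f (W w).
  by rewrite (laplace_transform_pos (ltW s0) survival_RV_ge0).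
pose lo k := expR (- (s * (k.+1%:R * h))).
pose hi k := expR (- (s * (k%:R * h))).
have bnd x k : k%:R * h < x <= k.+1%:R * h -> lo k <= f x <= hi k.
  move=> /andP[kx xk]; have x0 : 0 < x.
    by apply: le_lt_trans kx; rewrite mulr_ge0// ltW.
  rewrite /lo /hi /f (max_r (ltW x0)) !ler_expR !lerN2 !ler_pM2l//.
  by rewrite xk (ltW kx).
apply/andP; split.
  have -> : expR (- (s * h)) * S = \int[P]_w step_fun h N lo (W w).
    rewrite Rintegral_step_fun ?ltW// mulr_sumr; apply: eq_bigr => k _.
    rewrite mulrA -expRD; congr (expR _ * _).
    by rewrite /lo -natr1; ring.
  apply: le_Rintegral => //; first exact: step_fun_integrable.
  move=> w _; have /andP[H _] := step_fun_le N (ltW h0) (bnd (W w)).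
  by rewrite (le_trans H)// ler_piMr.
pose e := expR (- (s * (N%:R * h))).
have inthi := step_fun_integrable h N hi.
have intI0 := integrable_indic_RV W (measurable_itv `]-oo, 0%R]).
have intc : P.-integrable setT (EFin \o cst e).
  exact: finite_measure_integrable_cst.
(* The step function vanishes outside []0, N h]]: beyond it the constant [e] dominates [f], and
   below it the indicator of []-oo, 0]] does, at no cost because [G 0 = 1] gives it integral 0. *)
have -> : S + expR (- (s * (N%:R * h))) =
    \int[P]_w (step_fun h N hi (W w) + (e + \1_(`]-oo, 0%R]) (W w))).
  rewrite RintegralD//; last exact: (integrableD measurableT intc intI0).
  rewrite RintegralD// Rintegral_probability_cst Rintegral_indic_cdf//.
  rewrite G0 subrr addr0.
  by rewrite Rintegral_step_fun// ltW.
apply: le_Rintegral => //.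
  exact: (integrableD measurableT inthi (integrableD measurableT intc intI0)).
move=> w _; have /andP[_ H] := step_fun_le N (ltW h0) (bnd (W w)).
rewrite -lerBlDr (le_trans _ H)// {H}.
have fe : W w <= N%:R * h \/ f (W w) <= e.
  have [|Nw] := leP (W w) (N%:R * h); [by left|right].
  rewrite /f /e max_r; first by rewrite ler_expR lerN2 ler_pM2l// ltW.
  by rewrite (le_trans _ (ltW Nw))// mulr_ge0// ltW.
have e0 : 0 <= e := expR_ge0 _.
rewrite !indicE !mem_setE !in_itv/=; have f1 : f (W w) <= 1.
  by rewrite -expR0 ler_expR oppr_le0 mulr_ge0 ?le_max ?lexx// ltW.
move: (f0 (W w)) f1 fe.
case: (leP (W w) (N%:R * h)) => _; case: (leP (W w) 0) => _ /= ? ? [] *; lra.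
Qed.

End LaplaceRiemann.

(** * Laplace transform of a phase-type law *)

Section PhaseTypeLaplace.
Context {R : realType} d (O : measurableType d) (P : probability O R).
Context {p : nat} (pi : 'rV[R]_p) (T : 'M[R]_p) (W : {RV P >-> R}).
Context (PH : PH_generator pi T) (WPH : PH_distributed W pi T).

Lemma PH_ge0 : {ae P, forall w, 0 <= W w}.
Proof.
have [U subU WU] := PH_survival PH WPH.
apply: (survival_RV_ge0 _ WU).
exact: survival0 (PH_init_sum1 PH) subU.
Qed.

(** Row [i] of [s%:M - T] has nonpositive off-diagonal entries and sum [s] plus the exit rate of
    [i], which is positive, so diagonal dominance applies. *)
Lemma PH_resolvent_unitmx (s : R) : 0 < s -> s%:M - T \in unitmx.
Proof.
move=> s0; apply: diagonal_dominant_unitmx => [i j ij|i].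
  by rewrite !mxE (negbTE ij) mulr0n sub0r oppr_le0 (PH_offdiag_ge0 PH).
have := PH_exit_ge0 PH i; rewrite /exit_rates !mxE => ti.
have -> : \sum_j (s%:M - T) i j = s - \sum_j T i j * const_mx 1 j (0 : 'I_1).
  under eq_bigr do rewrite !mxE; rewrite sumrB; congr (_ - _).
    rewrite (bigD1 i)//= eqxx big1 ?addr0// => j.
    by rewrite eq_sym => /negbTE ->.
  by apply: eq_bigr => j _; rewrite mxE mulr1.
by rewrite ltr_wpDr.
Qed.

(** The vector [c] solves the resolvent equation, so both bounds of [laplace_bounds], taken on the
    grids of [cvg_discounted_loss], tend to [pi c] and squeeze the transform. *)
Lemma PH_laplace_transform (s : R) : 0 < s -> laplace_transform P W s =
  ((pi *m invmx (s%:M - T) *m exit_rates T) 0 0)%:E.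
Proof.
move=> s0; have [U subU WU] := PH_survival PH WPH.
have U0 := survival0 (PH_init_sum1 PH) subU.
pose c := invmx (s%:M - T) *m exit_rates T.
have cE : (s%:M - T) *m c = exit_rates T.
  by rewrite /c mulmxA mulmxV ?mul1mx// PH_resolvent_unitmx.
have Scvg := cvg_discounted_loss (PH_init_ge0 PH) (PH_init_sum1 PH) subU s0 cE.
rewrite -mulmxA -/c.
have -> : laplace_transform P W s = (fine (laplace_transform P W s))%:E.
  by rewrite (laplace_transform_pos (ltW s0) PH_ge0).
congr EFin; set l := fine _.
suff : cst l n @[n --> \oo] --> (pi *m c) 0 0.
  by move=> lc; apply: (cvg_unique _ _ lc) => //; exact: cvg_cst.
apply: squeeze_cvgr; first near=> n.
  have Nh : (n.+1 ^ 2)%:R * @harmonic R n = n.+1%:R.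
    by rewrite /= natrX expr2 -mulrA mulfV ?mulr1.
  have := laplace_bounds U0 WU (n.+1 ^ 2) s0 (harmonic_gt0 n).
  rewrite Nh; exact.
- apply: (@cvg_to_eq _ _ _ _ (expR (- (s * 0)) * (pi *m c) 0 0)).
    by rewrite mulr0 oppr0 expR0 mul1r.
  apply: cvgM => //; apply: continuous_cvg; first exact: continuous_expR.
  by apply: cvgN; apply: cvgM; [exact: cvg_cst|exact: cvg_harmonic].
- apply: (@cvg_to_eq _ _ _ _ ((pi *m c) 0 0 + 0)); first by rewrite addr0.
  by apply: cvgD => //; exact: cvg_expRN_natS.
Unshelve. all: by end_near.
Qed.

End PhaseTypeLaplace.

(** * Equality in law by comparison of Laplace transforms *)

Theorem theorem3p7 (R : realType) (alpha : R) (p : nat)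
    (pi : 'rV[R]_p) (T : 'M[R]_p)
    (d : measure_display) (O : measurableType d) (P : probability O R)
    (X : {RV P >-> R})
    (d' : measure_display) (O' : measurableType d') (P' : probability O' R)
    (W S : {RV P' >-> R}) :
  0 < alpha <= 1 ->
  PH_generator pi T ->
  MML_distributed X alpha pi T ->
  PH_distributed W pi T ->
  positive_stable S alpha ->
  independent_RV W S ->
  eq_in_law P P' X (fun w => W w `^ alpha^-1 * S w).
Proof.
move=> /andP[alpha0 _] PH [X_ge0 X_lap] WPH S_stable WS.
have W_ge0 := PH_ge0 PH WPH.
have mZ : measurable_fun setT (fun w => W w `^ alpha^-1 * S w).
  apply: measurable_funM => //.
  exact: (measurableT_comp (measurable_powR _)).
pose Z : {RV P' >-> R} :=
  HB.pack (fun w => W w `^ alpha^-1 * S w) (isMeasurableFun.Build _ _ _ _ _ mZ).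
apply: (@laplace_transform_inj _ _ _ _ _ _ _ X Z) => //.
  by apply: filterS S_stable.1 => w S0; rewrite mulr_ge0 ?powR_ge0// ltW.
(* The point [u = 0] is apart because [PH_laplace_transform] is for positive arguments; both
   transforms equal 1 there. *)
move=> u; rewrite le_eqVlt => /predU1P[<-|u0].
  rewrite /laplace_transform.
  under eq_fun do rewrite mul0r oppr0 expR0.
  under [in RHS]eq_fun do rewrite mul0r oppr0 expR0.
  by rewrite !expectation_cst.
rewrite X_lap ?ltW// laplace_transform_stable_mixture ?(ltW u0)//.
by rewrite (PH_laplace_transform PH WPH)// powR_gt0.
Qed.
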